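(* Let $\ell\ge 3$, let $\gamma_1,\dots,\gamma_\ell\ge 2$ be integers, and let $$G=\langle s_1,\dots,s_\ell \mid s_1^{\gamma_1},\dots,s_\ell^{\gamma_\ell},\ s_1s_2\cdots s_\ell\rangle .$$ Let $m$ be the number of indices $i$ with $\gamma_i\ge 3$, and let $n=\ell-m$ be the number of indices $i$ with $\gamma_i=2$. If $n$ is even, assume $m\ge 5$; if $n$ is odd, assume $m\ge 7$. Let $$\mathcal U=(s_1^{u_1},\dots,s_{j-1}^{u_{j-1}},s_{j+1}^{u_{j+1}},\dots,s_\ell^{u_\ell})\quad\text{and}\quad \mathcal V=(s_1^{v_1},\dots,s_{k-1}^{v_{k-1}},s_{k+1}^{v_{k+1}},\dots,s_\ell^{v_\ell})$$ be two standard generating systems of $G$, for some $j,k\in\{1,\dots,\ell\}$. Define $u_j=v_k=1$. Then $\mathcal U$ and $\mathcal V$ are Nielsen equivalent if and only if $$u_i\equiv \pm v_i \pmod{\gamma_i}\qquad\text{for all } i=1,\dots,\ell$$ (where the sign may depend on $i$).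
   Context: A family $\mathcal U=(s_1^{u_1},\dots,s_{j-1}^{u_{j-1}},s_{j+1}^{u_{j+1}},\dots,s_\ell^{u_\ell})$ of elements of $G$ (with the index $j$ omitted) is called a standard generating system of $G$ if $u_i\in\mathbb Z$ and $\gcd(u_i,\gamma_i)=1$ for all $i\ne j$. Nielsen equivalence: for an $n$-tuple $(x_1,\dots,x_n)$ of elements of a group, an elementary Nielsen operation is one of: (1) a permutation of the $x_i$; (2) replacing some $x_i$ by $x_ix_j$ or by $x_jx_i$ with $j\ne i$, leaving the other entries unchanged; (3) replacing some $x_i$ by $x_i^{-1}$, leaving the other entries unchanged. Two tuples are Nielsen equivalent if one is obtained from the other by a finite sequence of elementary Nielsen operations. *)

(* Defs.v *)
From HB Require Import structures.
From Stdlib Require Import Relation_Operators.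
From mathcomp Require Import all_boot all_order all_fingroup all_algebra.
From mathcomp Require Import boolp.

Set Implicit Arguments.
Unset Strict Implicit.
Unset Printing Implicit Defensive.

Local Open Scope quotient_scope.
Local Open Scope group_scope.

(* A letter (i, true) stands for the generator indexed by i, and (i, false)
   for its formal inverse. *)
Definition word (I : Type) := seq (I * bool).

Definition inv_letter (I : Type) (a : I * bool) : I * bool := (a.1, ~~ a.2).

Definition inv_word (I : Type) (w : word I) : word I :=
  rev (map (@inv_letter I) w).

(* The least congruence on words containing the free cancellations and r ~ 1
   for every relator r: equality in the quotient of the free group on I by the
   normal closure of the relators. *)
Inductive pres_eq (I : Type) (rel : word I -> Prop) : word I -> word I -> Prop :=
| pres_refl w : pres_eq rel w w
| pres_sym w1 w2 : pres_eq rel w1 w2 -> pres_eq rel w2 w1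
| pres_trans w1 w2 w3 :
    pres_eq rel w1 w2 -> pres_eq rel w2 w3 -> pres_eq rel w1 w3
| pres_cancel w1 a w2 :
    pres_eq rel (w1 ++ [:: a; inv_letter a] ++ w2) (w1 ++ w2)
| pres_relator w1 r w2 : rel r -> pres_eq rel (w1 ++ r ++ w2) (w1 ++ w2).

Section PresentedGroup.
Variables (I : choiceType) (rel : word I -> Prop).

Definition pres_eqb (w1 w2 : word I) : bool := `[< pres_eq rel w1 w2 >].

Lemma pres_eqb_refl : reflexive pres_eqb.
Proof. by move=> w; apply/asboolP; constructor. Qed.

Lemma pres_eqb_sym : symmetric pres_eqb.
Proof. by move=> w1 w2; apply/asboolP/asboolP; apply: pres_sym. Qed.

Lemma pres_eqb_trans : transitive pres_eqb.
Proof.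
by move=> w2 w1 w3 /asboolP h12 /asboolP h23; apply/asboolP/(pres_trans h12).
Qed.

Canonical pres_equiv :=
  EquivRel pres_eqb pres_eqb_refl pres_eqb_sym pres_eqb_trans.

Definition presented_group : Type := {eq_quot pres_equiv}.

HB.instance Definition _ := Choice.on presented_group.

Definition pres_class (w : word I) : presented_group :=
  \pi_({eq_quot pres_equiv}) w.

Definition pres_repr (x : presented_group) : word I :=
  generic_quotient.repr (x : {eq_quot pres_equiv}).

Lemma pres_reprK x : pres_class (pres_repr x) = x.
Proof. exact: generic_quotient.reprK. Qed.

Lemma pres_classP w1 w2 : pres_class w1 = pres_class w2 <-> pres_eq rel w1 w2.
Proof.
split=> [/eqP|h]; first by rewrite /pres_class eqmodE => /asboolP.
by apply/eqP; rewrite /pres_class eqmodE; apply/asboolP.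
Qed.

Lemma pres_eq_repr w : pres_eq rel (pres_repr (pres_class w)) w.
Proof. by apply/pres_classP; rewrite pres_reprK. Qed.

Lemma pres_eq_ctx a b w1 w2 :
  pres_eq rel w1 w2 -> pres_eq rel (a ++ w1 ++ b) (a ++ w2 ++ b).
Proof.
elim=> {w1 w2} [w|w1 w2 _|w1 w2 w3 _ h1 _|w1 c w2|w1 r w2 hr].
- exact: pres_refl.
- exact: pres_sym.
- exact: pres_trans.
- by have := pres_cancel rel (a ++ w1) c (w2 ++ b); rewrite -!catA.
- by have := pres_relator (a ++ w1) (w2 ++ b) hr; rewrite -!catA.
Qed.

Lemma pres_eq_cat a1 a2 b1 b2 :
  pres_eq rel a1 a2 -> pres_eq rel b1 b2 -> pres_eq rel (a1 ++ b1) (a2 ++ b2).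
Proof.
move=> ha hb; apply: (@pres_trans _ _ _ (a2 ++ b1)).
  by have := pres_eq_ctx [::] b1 ha.
by have := pres_eq_ctx a2 [::] hb; rewrite !cats0.
Qed.

Lemma inv_wordK : involutive (@inv_word I).
Proof.
move=> w; rewrite /inv_word map_rev revK -map_comp map_id_in // => -[i b] _.
by rewrite /inv_letter /= negbK.
Qed.

Lemma pres_mulwV w : pres_eq rel (w ++ inv_word w) [::].
Proof.
elim: w => [|a w IHw]; first exact: pres_refl.
rewrite /inv_word map_cons rev_cons -cats1 catA cat_cons.
apply: (@pres_trans _ _ _ [:: a; inv_letter a]).
  by have := pres_eq_ctx [:: a] [:: inv_letter a] IHw.
exact: (pres_cancel rel [::] a [::]).
Qed.

Lemma pres_mulVw w : pres_eq rel (inv_word w ++ w) [::].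
Proof. by have := pres_mulwV (inv_word w); rewrite inv_wordK. Qed.

Lemma pres_eq_inv w1 w2 :
  pres_eq rel w1 w2 -> pres_eq rel (inv_word w1) (inv_word w2).
Proof.
move=> h; apply: (@pres_trans _ _ _ (inv_word w1 ++ w2 ++ inv_word w2)).
  have := pres_eq_cat (pres_refl rel (inv_word w1)) (pres_sym (pres_mulwV w2)).
  by rewrite cats0.
rewrite catA.
have h1 : pres_eq rel (inv_word w1 ++ w2) [::].
  apply: pres_trans (pres_mulVw w1).
  exact: pres_eq_cat (pres_refl _ _) (pres_sym h).
by have := pres_eq_cat h1 (pres_refl rel (inv_word w2)).
Qed.

Definition pres_mul (x y : presented_group) : presented_group :=
  pres_class (pres_repr x ++ pres_repr y).
Definition pres_inv (x : presented_group) : presented_group :=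
  pres_class (inv_word (pres_repr x)).
Definition pres_one : presented_group := pres_class [::].

Lemma pres_mulE w1 w2 :
  pres_mul (pres_class w1) (pres_class w2) = pres_class (w1 ++ w2).
Proof. by apply/pres_classP; apply: pres_eq_cat; exact: pres_eq_repr. Qed.

Lemma pres_invE w : pres_inv (pres_class w) = pres_class (inv_word w).
Proof. by apply/pres_classP; apply: pres_eq_inv; exact: pres_eq_repr. Qed.

Lemma pres_mulA : associative pres_mul.
Proof.
move=> x y z; rewrite -[x]pres_reprK -[y]pres_reprK -[z]pres_reprK.
by rewrite !pres_mulE catA.
Qed.

Lemma pres_mul1 : left_id pres_one pres_mul.
Proof. by move=> x; rewrite -[x]pres_reprK pres_mulE. Qed.

Lemma pres_mulr1 : right_id pres_one pres_mul.
Proof. by move=> x; rewrite -[x]pres_reprK pres_mulE cats0. Qed.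

Lemma pres_mulV : left_inverse pres_one pres_inv pres_mul.
Proof.
move=> x; rewrite -[x]pres_reprK pres_invE pres_mulE.
by apply/pres_classP; exact: pres_mulVw.
Qed.

Lemma pres_mulrV : right_inverse pres_one pres_inv pres_mul.
Proof.
move=> x; rewrite -[x]pres_reprK pres_invE pres_mulE.
by apply/pres_classP; exact: pres_mulwV.
Qed.

HB.instance Definition _ := isGroup.Build presented_group
  pres_mulA pres_mul1 pres_mulr1 pres_mulV pres_mulrV.

Definition pres_gen (i : I) : presented_group := pres_class [:: (i, true)].

End PresentedGroup.

Section UniversalProperty.
Variables (I : choiceType) (rel : word I -> Prop) (H : groupType) (f : I -> H).

Definition eval_word (w : word I) : H :=
  \prod_(a <- w) (if a.2 then f a.1 else (f a.1)^-1).

Lemma eval_word_pres_eq w1 w2 :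
  (forall r, rel r -> eval_word r = 1) ->
  pres_eq rel w1 w2 -> eval_word w1 = eval_word w2.
Proof.
move=> hf; elim=> {w1 w2} // [w1 w2 w3 _ -> //|w1 [i b] w2|w1 r w2 hr].
  rewrite /eval_word !big_cat !big_cons big_nil /=.
  by case: b => /=; rewrite mulg1 ?mulgV ?mulVg mul1g.
by move: (hf _ hr); rewrite /eval_word !big_cat /= => ->; rewrite mul1g.
Qed.

Definition pres_lift (x : presented_group rel) : H := eval_word (pres_repr x).

Lemma pres_liftE (hf : forall r, rel r -> eval_word r = 1) w :
  pres_lift (pres_class rel w) = eval_word w.
Proof. exact/(eval_word_pres_eq hf)/pres_eq_repr. Qed.

Lemma pres_lift_gen (hf : forall r, rel r -> eval_word r = 1) i :
  pres_lift (pres_gen rel i) = f i.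
Proof. by rewrite pres_liftE // /eval_word big_seq1. Qed.

Lemma pres_liftM (hf : forall r, rel r -> eval_word r = 1) :
  {morph pres_lift : x y / x * y}.
Proof.
move=> x y; rewrite -[x]pres_reprK -[y]pres_reprK.
have -> : pres_class rel (pres_repr x) * pres_class rel (pres_repr y)
  = pres_class rel (pres_repr x ++ pres_repr y) by exact: pres_mulE.
by rewrite !pres_liftE // /eval_word big_cat.
Qed.

End UniversalProperty.

Lemma pres_class_gen (I : choiceType) (rel : word I -> Prop) (w : word I) :
  pres_class rel w = eval_word (pres_gen rel) w.
Proof.
elim: w => [|[i b] w IHw]; first by rewrite /eval_word big_nil.
rewrite /eval_word big_cons -[X in _ = _ * X]IHw /=.
rewrite -cat1s -(pres_mulE rel [:: (i, b)] w); congr (_ * _).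
by case: b => //; rewrite [LHS](_ : _ = pres_inv (pres_gen rel i)) // pres_invE.
Qed.

Definition expgz (G : groupType) (x : G) (z : int) : G :=
  match z with
  | Posz n => x ^+ n
  | Negz n => x ^- n.+1
  end.

Section Nielsen.
Variables (G : groupType) (n : nat).

Inductive elementary_nielsen : n.-tuple G -> n.-tuple G -> Prop :=
| nielsen_perm (x : n.-tuple G) (p : 'S_n) :
    elementary_nielsen x [tuple tnth x (p a) | a < n]
| nielsen_mulr (x : n.-tuple G) (i j : 'I_n) : j != i ->
    elementary_nielsen x
      [tuple if a == i then tnth x i * tnth x j else tnth x a | a < n]
| nielsen_mull (x : n.-tuple G) (i j : 'I_n) : j != i ->
    elementary_nielsen x
      [tuple if a == i then tnth x j * tnth x i else tnth x a | a < n]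
| nielsen_inv (x : n.-tuple G) (i : 'I_n) :
    elementary_nielsen x
      [tuple if a == i then (tnth x i)^-1 else tnth x a | a < n].

Definition nielsen_equivalent : n.-tuple G -> n.-tuple G -> Prop :=
  clos_refl_trans _ elementary_nielsen.

End Nielsen.

Section PolygonGroup.
Variables (l : nat) (gamma : 'I_l -> nat).

Inductive polygon_relator : word 'I_l -> Prop :=
| polygon_relator_power i : polygon_relator (nseq (gamma i) (i, true))
| polygon_relator_prod : polygon_relator [seq (i, true) | i <- enum 'I_l].

Definition polygon_group : groupType := presented_group polygon_relator.

Definition polygon_gen (i : 'I_l) : polygon_group := pres_gen polygon_relator i.

Definition standard_generating_system (j : 'I_l) (u : 'I_l -> int)
    (U : (l.-1).-tuple polygon_group) : Prop :=
  (forall i, i != j -> coprimez (u i) (gamma i)%:Z) /\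
  (* lift j enumerates the indices other than j in increasing order *)
  U = [tuple expgz (polygon_gen (lift j a)) (u (lift j a)) | a < l.-1].

End PolygonGroup.

(* Main.v *)
Require Import Defs.
From HB Require Import structures.
From Stdlib Require Import Relation_Operators.
From mathcomp Require Import all_boot all_order all_fingroup all_algebra.
From mathcomp Require Import all_solvable all_field ring.

(** Write [s_i] for the generators of the polygon group G and g_i for their
    orders, and call standard the tuples (s_i^(e_i)), i <> j, with e_i prime to
    g_i and e_j = 1.

    The classes are separated by a determinant.  Choose for every i a primitive
    g_i-th root of unity z_i, and matrices A_i in SL2, similar to
    diag(z_i, 1/z_i), whose product in order is 1.  If g_i = 2 then A_i = -1 is
    central; the other A_i can be fitted together as soon as there are three of
    them ([eigen_product3]).  Since z_i is not 1, the matrix 1 - A_i is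
    invertible, so in the affine group of the x |-> A x + D with A in SL2 and D
    a 2 x N matrix every element with linear part A_i has order dividing g_i
    ([saff_order]).  Hence the representation s_i |-> A_i lifts to the affine
    group with arbitrary translation parts at all generators but the first: a
    crossed homomorphism D(xy) = D(x) + A(x) D(y) on G can be prescribed freely
    there.  Take N = 2(l - 1) and let the values of D be the block rows of the
    identity matrix ([polygon_affine_representation]).

    Stacking the values of D at the entries of an (l-1)-tuple gives a square
    matrix.  A Nielsen move acts on it by a block row operation whose diagonal
    block has determinant 1, because the linear parts lie in SL2, or by a
    permutation of the blocks.  So the square of the determinant is a Nielsen
    invariant ([nielsen_transl_det]).  It plays the role of the determinant of
    the Fox Jacobian evaluated at a representation.

    Because (1 - A) D(x^e) = (1 - A^e) D(x), the determinant at a standard tuple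
    is the one at the s_i, i <> j, times the product of the quotients
    tau(z_i^(e_i)) / tau(z_i), where tau(z) = (1 - z)(1 - 1/z) is the
    determinant of 1 - diag(z, 1/z).  The tuples of all s_i but one are Nielsen
    equivalent to each other, so the determinant there is 1 up to sign.  Hence,
    if the standard tuples with exponents e and f are equivalent, the products
    of the tau(z_i^(e_i)) and of the tau(z_i^(f_i)) agree up to sign for every
    choice of the primitive roots ([nielsen_prod_tau]).

    On complex roots of unity tau(z) = |1 - z|^2, so the sign disappears.  If
    only one z_i varies, then tau(y^(e_i)) = C tau(y^(f_i)) with one constant
    C > 0 for all primitive roots y, and this forces C = 1 ([tau_ratio_eq1]).
    As tau determines a root of unity up to inversion, e_i = f_i or e_i = -f_i
    modulo g_i ([prod_tau_separation]).

    Conversely the entries of a tuple can be inverted one at a time, and where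
    s_k stands with exponent 1 the relation s_1 ... s_l = 1 turns it into s_j by
    multiplications by words in the other entries ([nielsen_standard_tuples]). *)

Set Implicit Arguments.
Unset Strict Implicit.
Unset Printing Implicit Defensive.
Import Order.TTheory GRing.Theory Num.Theory.

(** * Nielsen moves *)

Section NielsenMoves.
Local Open Scope group_scope.
Variables (G : groupType) (n : nat).
Implicit Types (x : n.-tuple G) (a b : 'I_n) (g h : G).

Definition set_entry x a g : n.-tuple G :=
  [tuple if b == a then g else tnth x b | b < n].

Lemma set_entry_id x a : set_entry x a (tnth x a) = x.
Proof. by apply: eq_from_tnth => b; rewrite tnth_mktuple; case: eqP => [->|]. Qed.

Lemma nielsen_trans x y z :
  nielsen_equivalent x y -> nielsen_equivalent y z -> nielsen_equivalent x z.
Proof. exact: rt_trans. Qed.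

Definition reachable_entry x a g := nielsen_equivalent x (set_entry x a g).

Lemma reachable_entryV x a g : reachable_entry x a g -> reachable_entry x a g^-1.
Proof.
move=> Rg; apply: nielsen_trans Rg _; apply: rt_step.
have := nielsen_inv (set_entry x a g) a; congr elementary_nielsen.
by apply: eq_from_tnth => b; rewrite !tnth_mktuple eqxx; case: eqP.
Qed.

Lemma reachable_entryMr x a b g : b != a ->
  reachable_entry x a g -> reachable_entry x a (g * tnth x b).
Proof.
move=> ba Rg; apply: nielsen_trans Rg _; apply: rt_step.
have := nielsen_mulr (set_entry x a g) ba; congr elementary_nielsen.
apply: eq_from_tnth => c; rewrite !tnth_mktuple eqxx (negbTE ba).
by case: eqP.
Qed.

Lemma reachable_entryMl x a b g : b != a ->
  reachable_entry x a g -> reachable_entry x a (tnth x b * g).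
Proof.
move=> ba Rg; apply: nielsen_trans Rg _; apply: rt_step.
have := nielsen_mull (set_entry x a g) ba; congr elementary_nielsen.
apply: eq_from_tnth => c; rewrite !tnth_mktuple eqxx (negbTE ba).
by case: eqP.
Qed.

(** Since [reachable_entry x a] is invariant under inversion, these multipliers
    form a group; it contains the other entries of [x], hence all words in
    them. *)
Definition entry_multiplier x a h := forall g,
  reachable_entry x a g -> reachable_entry x a (g * h) /\ reachable_entry x a (h * g).

Lemma entry_multiplier_entry x a b : b != a -> entry_multiplier x a (tnth x b).
Proof.
by move=> ba g Rg; split; [apply: reachable_entryMr|apply: reachable_entryMl].
Qed.

Lemma entry_multiplier1 x a : entry_multiplier x a 1.
Proof. by move=> g; rewrite mulg1 mul1g. Qed.

Lemma entry_multiplierM x a h1 h2 :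
  entry_multiplier x a h1 -> entry_multiplier x a h2 -> entry_multiplier x a (h1 * h2).
Proof.
move=> H1 H2 g Rg; split; first by rewrite mulgA; apply H2; apply H1.
by rewrite -mulgA; apply H1; apply H2.
Qed.

Lemma entry_multiplierV x a h : entry_multiplier x a h -> entry_multiplier x a h^-1.
Proof.
move=> Hh g /reachable_entryV /Hh[/reachable_entryV Rr /reachable_entryV Rl].
by move: Rl Rr; rewrite !invgM !invgK.
Qed.

Lemma entry_multiplierX x a h e : entry_multiplier x a h -> entry_multiplier x a (h ^+ e).
Proof.
move=> Hh; elim: e => [|e IHe]; first exact: entry_multiplier1.
by rewrite expgS; apply: entry_multiplierM.
Qed.

Lemma entry_multiplier_prod x a (I : eqType) (r : seq I) (F : I -> G) :
  (forall i, i \in r -> entry_multiplier x a (F i)) ->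
  entry_multiplier x a (\prod_(i <- r) F i).
Proof.
move=> HF; rewrite big_seq; apply: (big_ind (entry_multiplier x a)) => //.
  exact: entry_multiplier1.
exact: entry_multiplierM.
Qed.

Lemma nielsen_signs x y :
  (forall a, tnth y a = tnth x a \/ tnth y a = (tnth x a)^-1) ->
  nielsen_equivalent x y.
Proof.
move=> xy.
(* [mix c] has already been changed in its first [c] entries. *)
pose mix c : n.-tuple G := [tuple if (a < c)%N then tnth y a else tnth x a | a < n].
have -> : y = mix n by apply: eq_from_tnth => a; rewrite tnth_mktuple ltn_ord.
suff mixP c : (c <= n)%N -> nielsen_equivalent x (mix c) by apply: mixP.
elim: c => [_|c IHc ltcn].
  have -> : mix 0 = x by apply: eq_from_tnth => a; rewrite tnth_mktuple.
  exact: rt_refl.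
apply: nielsen_trans (IHc (ltnW ltcn)) _.
pose a := Ordinal ltcn.
have mixS : mix c.+1 = set_entry (mix c) a (tnth y a).
  apply: eq_from_tnth => b; rewrite !tnth_mktuple ltnS leq_eqVlt -val_eqE /=.
  by case: eqP => //= bc; have -> : b = a by apply: val_inj.
have mixa : tnth (mix c) a = tnth x a by rewrite tnth_mktuple ltnn.
have R0 : reachable_entry (mix c) a (tnth x a).
  by rewrite /reachable_entry -mixa set_entry_id; apply: rt_refl.
by rewrite mixS; have [->|->] := xy a; [|apply: reachable_entryV].
Qed.

End NielsenMoves.

Section OmittedEntry.
Local Open Scope group_scope.

(** Splitting the relation at [s j] gives [s j = (prod r1)^-1 * (prod r2)^-1],
    and [s k] is a factor of exactly one of the two products; the other factors
    may be multiplied in freely. *)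
Lemma prod1_reachable (G : groupType) (n l : nat) (x : n.-tuple G) (a : 'I_n)
    (s : 'I_l -> G) (j k : 'I_l) :
  j != k -> \prod_(i < l) s i = 1 ->
  (forall i, i != j -> i != k -> entry_multiplier x a (s i)) ->
  reachable_entry x a (s k) -> reachable_entry x a (s j).
Proof.
move=> jk prod_s sM Rk.
move: prod_s (mem_index_enum j) (mem_index_enum k) (index_enum_uniq 'I_l).
move: (index_enum 'I_l) => r prod_r jr; case/splitPr: jr prod_r => r1 r2 prod_r kr ur.
have subM (r' : seq 'I_l) : j \notin r' -> k \notin r' ->
    entry_multiplier x a (\prod_(i <- r') s i).
  by move=> jr kr'; apply: entry_multiplier_prod => i ir; apply: sM;
    apply: contraTneq ir => ->.
have {prod_r} -> : s j = (\prod_(i <- r1) s i)^-1 * (\prod_(i <- r2) s i)^-1.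
  move: prod_r; rewrite big_cat big_cons /= mulgA => /mulg1_eq <-.
  by rewrite invgK mulKg.
move: ur kr; rewrite cat_uniq cons_uniq mem_cat inE eq_sym (negbTE jk) /=.
rewrite negb_or => /and3P[ur1 /andP[jr1 /hasPn r12] /andP[jr2 ur2]].
have around (p q : seq 'I_l) : uniq (p ++ k :: q) -> j \notin p ++ k :: q ->
    reachable_entry x a (\prod_(i <- p ++ k :: q) s i)^-1.
  rewrite cat_uniq cons_uniq mem_cat !inE !negb_or => /and3P[_ /andP[kp _] /andP[kq _]].
  case/and3P=> jp _ jq; apply: reachable_entryV.
  rewrite big_cat big_cons /=.
  have [] := subM p jp kp (s k * \prod_(i <- q) s i) => //.
  by have [] := subM q jq kq (s k).
case/orP => [kr1|kr2].
  have kr2 : k \notin r2 by apply: contraL kr1 => /r12.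
  have [] := entry_multiplierV (subM r2 jr2 kr2)
      (g := (\prod_(i <- r1) s i)^-1) => //.
  by case/splitPr: kr1 ur1 jr1 => p q; apply: around.
have [] := entry_multiplierV (subM r1 jr1 (r12 _ kr2))
    (g := (\prod_(i <- r2) s i)^-1) => //.
by case/splitPr: kr2 ur2 jr2 => p q; apply: around.
Qed.

Definition omit_tuple (G : Type) (n : nat) (i0 : 'I_n.+1) (g : 'I_n.+1 -> G) :
  n.-tuple G := [tuple g (lift i0 a) | a < n].

(** The entry [g k] becomes [g j], after which both tuples list the same
    elements in a different order. *)
Lemma nielsen_omit_exchange (G : groupType) (n : nat) (g : 'I_n.+1 -> G)
    (j k : 'I_n.+1) :
  (forall a, lift j a = k -> reachable_entry (omit_tuple j g) a (g j)) ->
  nielsen_equivalent (omit_tuple j g) (omit_tuple k g).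
Proof.
case: (eqVneq j k) => [-> _|jk Rj]; first exact: rt_refl.
have [a ka _] := unlift_some jk.
apply: nielsen_trans (Rj a (esym ka)) _.
(* [q b] is the position, in the tuple without [j], of what must end up at
   position [b] in the tuple without [k]; the new entry stands where [k] was. *)
have qP (b : 'I_n) : {c | (if lift k b == j then k else lift k b) = lift j c}.
  have: j != (if lift k b == j then k else lift k b) by case: ifP => // /negbT; rewrite eq_sym.
  by case/unlift_some=> c -> _; exists c.
pose q b := sval (qP b).
have qE b : lift j (q b) = (if lift k b == j then k else lift k b) := esym (svalP (qP b)).
have q_inj : injective q.
  move=> b c bc; apply: (@lift_inj _ k); move: (qE b) (qE c); rewrite bc => ->.
  case: eqP => [->|_]; case: eqP => [->|_] // e.
    by move/eqP: e; rewrite (negbTE (neq_lift k c)).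
  by move/eqP: e; rewrite eq_sym (negbTE (neq_lift k b)).
apply: rt_step; have := nielsen_perm (set_entry (omit_tuple j g) a (g j)) (perm q_inj).
congr elementary_nielsen; apply: eq_from_tnth => b; rewrite !tnth_mktuple permE.
rewrite -(inj_eq (@lift_inj _ j)) qE -ka.
by case: (eqVneq (lift k b) j) => [->|_]; rewrite ?eqxx // eq_sym (negbTE (neq_lift k b)).
Qed.

End OmittedEntry.

(** * Exponents modulo the order *)

Section Residues.
Local Open Scope ring_scope.

Definition residue (u : int) (g : nat) : nat := `|(u %% g%:Z)%Z|%N.

Lemma residueE u g : (0 < g)%N -> (residue u g)%:Z = (u %% g%:Z)%Z.
Proof. by move=> g0; rewrite /residue gez0_abs // modz_ge0 // eqz_nat -lt0n. Qed.

Lemma coprime_residue u g : coprimez u g%:Z -> coprime (residue u g) g.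
Proof. by rewrite /coprimez -gcdz_modl. Qed.

Lemma residue_eqP u v g : (0 < g)%N ->
  (u = v %[mod g%:Z])%Z <-> residue u g = residue v g %[mod g].
Proof.
move=> g0; split=> [uv|]; first by rewrite /residue uv.
by move/(congr1 Posz); rewrite -!modz_nat !residueE // !modz_mod.
Qed.

Lemma residue_oppP u v g : (0 < g)%N ->
  (u = - v %[mod g%:Z])%Z <-> (g %| residue u g + residue v g)%N.
Proof.
move=> g0; have -> : (g %| residue u g + residue v g)%N = (u == - v %[mod g%:Z])%Z.
  rewrite eqz_mod_dvd opprK -[LHS]/(g%:Z %| (residue u g + residue v g)%N%:Z)%Z.
  by rewrite PoszD !residueE //; apply/dvdz_mod0P/dvdz_mod0P; rewrite modzDm.
by split=> [/eqP|/eqP].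
Qed.

End Residues.

Section GroupPowers.
Local Open Scope group_scope.
Variable G : groupType.
Implicit Types x : G.

Lemma expg_modn x g k : x ^+ g = 1 -> x ^+ (k %% g)%N = x ^+ k.
Proof.
by move=> xg; rewrite [in RHS](divn_eq k g) mulnC expgnDr expgnA xg expg1n mul1g.
Qed.

Lemma expg_coprime_root x g k : (0 < g)%N -> x ^+ g = 1 -> coprime k g ->
  exists w, x ^+ k ^+ w = x.
Proof.
(* Euler: the inverse of [k] modulo [g] is a power of [k]. *)
move=> g0 xg ckg; exists (k ^ (totient g).-1)%N.
rewrite -expgnA -expnS prednK ?totient_gt0 // -(expg_modn _ xg).
by rewrite Euler_exp_totient // expg_modn.
Qed.

Lemma expgz_residue x g u : (0 < g)%N -> x ^+ g = 1 ->
  expgz x u = x ^+ residue u g.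
Proof.
move=> g0 xg; case: u => m /=.
  by rewrite /residue modz_nat absz_nat expg_modn.
apply: (mulIg (x ^+ m.+1)); rewrite mulVg -expgnDr.
have: (g %| residue (Negz m) g + m.+1)%N.
  suff: (Posz g %| Posz (residue (Negz m) g + m.+1)%N)%Z by rewrite dvdzE !absz_nat.
  rewrite PoszD residueE // -[Posz m.+1]GRing.opprK -NegzE.
  by rewrite -eqz_mod_dvd modz_mod.
by case/dvdnP=> q ->; rewrite mulnC expgnA xg expg1n.
Qed.

End GroupPowers.

(** * The polygon group and its standard tuples *)

Section PolygonRelations.
Local Open Scope group_scope.
Variables (l : nat) (gamma : 'I_l -> nat).
Local Notation s := (polygon_gen gamma).

Lemma eval_word_power (H : groupType) (f : 'I_l -> H) i k :
  eval_word f (nseq k (i, true)) = f i ^+ k.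
Proof. by rewrite /eval_word big_nseq iter_mulg_1. Qed.

Lemma eval_word_prod (H : groupType) (f : 'I_l -> H) :
  eval_word f [seq (i, true) | i <- enum 'I_l] = \prod_(i < l) f i.
Proof. by rewrite /eval_word big_map enumT. Qed.

Lemma polygon_relator1 r :
  polygon_relator gamma r -> eval_word s r = 1.
Proof.
move=> rr; rewrite -[LHS]pres_class_gen.
by apply/pres_classP; have := pres_relator [::] [::] rr; rewrite cats0.
Qed.

Lemma polygon_gen_order i : s i ^+ gamma i = 1.
Proof. by rewrite -eval_word_power polygon_relator1 //; constructor. Qed.

Lemma polygon_gen_prod : \prod_(i < l) s i = 1.
Proof. by rewrite -eval_word_prod polygon_relator1 //; constructor. Qed.

End PolygonRelations.

Section StandardTuples.
Local Open Scope group_scope.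
Variables (n : nat) (gamma : 'I_n.+1 -> nat) (gamma_gt0 : forall i, (0 < gamma i)%N).
Local Notation s := (polygon_gen gamma).

(** Every [s i] is a power of [s i ^+ w i], so the relation
    [\prod_i s i = 1] can be used although only these powers are entries of the
    tuple. *)
Lemma polygon_exchange (w : 'I_n.+1 -> nat) (j k : 'I_n.+1) :
  (forall i, coprime (w i) (gamma i)) -> w j = 1%N -> w k = 1%N ->
  nielsen_equivalent (omit_tuple j (fun i => s i ^+ w i))
                     (omit_tuple k (fun i => s i ^+ w i)).
Proof.
move=> cw wj wk; apply: nielsen_omit_exchange => a ka.
have jk : j != k by rewrite -ka neq_lift.
rewrite wj expg1; apply: (prod1_reachable jk (polygon_gen_prod gamma)); last first.
  have := rt_refl _ (@elementary_nielsen _ n) (omit_tuple j (fun i => s i ^+ w i)).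
  by rewrite -{2}(set_entry_id (omit_tuple j _) a) tnth_mktuple ka wk expg1.
move=> i ij ik.
have [m {1}<-] := expg_coprime_root (gamma_gt0 i) (polygon_gen_order gamma i) (cw i).
apply: entry_multiplierX; rewrite eq_sym in ij.
have [b ib _] := unlift_some ij.
have -> : s i ^+ w i = tnth (omit_tuple j (fun i => s i ^+ w i)) b by rewrite tnth_mktuple -ib.
apply: entry_multiplier_entry; apply: contraNneq ik => ba.
by rewrite ib ba ka.
Qed.

(** The exponents are first changed from [e] to [f] at all entries; then [s k],
    which now has exponent 1, is exchanged for [s j]; last, [s j] is inverted if
    [f j] requires it. *)
Lemma nielsen_standard_tuples (e f : 'I_n.+1 -> nat) (j k : 'I_n.+1) :
  (forall i, coprime (f i) (gamma i)) -> e j = 1%N -> f k = 1%N ->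
  (forall i, s i ^+ f i = s i ^+ e i \/ s i ^+ f i = (s i ^+ e i)^-1) ->
  nielsen_equivalent (omit_tuple j (fun i => s i ^+ e i))
                     (omit_tuple k (fun i => s i ^+ f i)).
Proof.
move=> cf ej fk ef; pose w i := if i == j then 1%N else f i.
have [wj wk] : w j = 1%N /\ w k = 1%N by rewrite /w eqxx; case: eqP.
apply: (nielsen_trans (y := omit_tuple j (fun i => s i ^+ w i))).
  apply: nielsen_signs => a; rewrite !tnth_mktuple /w eq_sym (negbTE (neq_lift j a)).
  exact: ef.
apply: nielsen_trans (polygon_exchange _ wj wk) _.
  by move=> i; rewrite /w; case: eqP => // _; rewrite coprime1n.
apply: nielsen_signs => a; rewrite !tnth_mktuple /w.
case: eqP => [->|_]; last by left.
by have := ef j; rewrite ej.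
Qed.

End StandardTuples.

(** * Matrices in SL2 with prescribed eigenvalues and product *)

Section TwoByTwo.
Local Open Scope ring_scope.
Variable F : fieldType.
Implicit Types (a b c d x y z t : F) (A B P Q : 'M[F]_2).

Definition mx22 a b c d : 'M[F]_2 :=
  \matrix_(i, j) if i == 0 then if j == 0 then a else b
                 else if j == 0 then c else d.

Lemma mx22_eta A : A = mx22 (A 0 0) (A 0 1) (A 1 0) (A 1 1).
Proof.
apply/matrixP=> i j; rewrite !mxE.
by case: i => -[|[|//]] lti; case: j => -[|[|//]] ltj /=; congr (A _ _); apply: val_inj.
Qed.

Lemma mulmx22 a b c d a' b' c' d' :
  mx22 a b c d *m mx22 a' b' c' d' =
  mx22 (a * a' + b * c') (a * b' + b * d') (c * a' + d * c') (c * b' + d * d').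
Proof.
apply/matrixP=> i j; rewrite !mxE !big_ord_recl big_ord0 !mxE addr0 /=.
by case: (i == 0); case: (j == 0).
Qed.

Lemma det_mx22 a b c d : \det (mx22 a b c d) = a * d - b * c.
Proof.
rewrite (expand_det_row _ 0) !big_ord_recl big_ord0 addr0 /cofactor.
by rewrite !det_mx11 !mxE /= expr0 expr1 mul1r mulN1r mulrN.
Qed.

Lemma scalar_mx22 k : k%:M = mx22 k 0 0 k.
Proof.
by apply/matrixP=> i j; rewrite !mxE; case: i => -[|[|//]] ?; case: j => -[|[|//]] ?.
Qed.

Definition diag_inv z := mx22 z 0 0 z^-1.

(** Similarity rather than a condition on the eigenvalues: it passes to powers,
    also when these have [1] or [-1] as a double eigenvalue. *)
Definition has_eigenpair A z := exists2 P, P \in unitmx & A *m P = P *m diag_inv z.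

Lemma mx22_unit a b c d : a * d - b * c != 0 -> mx22 a b c d \in unitmx.
Proof. by move=> nz; rewrite unitmxE det_mx22 unitfE. Qed.

Lemma has_eigenpair_conj A B Q z :
  Q \in unitmx -> A *m Q = Q *m B -> has_eigenpair B z -> has_eigenpair A z.
Proof.
move=> uQ AQ [P uP BP]; exists (Q *m P); first by rewrite unitmx_mul uQ.
by rewrite mulmxA AQ -!mulmxA BP.
Qed.

Lemma has_eigenpairN A z : has_eigenpair A z -> has_eigenpair (- A) (- z).
Proof.
case=> P uP AP; exists P => //; rewrite mulNmx AP -mulmxN; congr (_ *m _).
by apply/matrixP=> i j; rewrite !mxE invrN; case: ifP; case: ifP; rewrite ?oppr0.
Qed.

Lemma det_has_eigenpair A z : z != 0 -> has_eigenpair A z -> \det A = 1.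
Proof.
move=> z0 [P uP /(congr1 determinant)]; rewrite !det_mulmx mulrC.
have uD : \det P \is a GRing.unit by rewrite -unitmxE.
by move/(mulrI uD) ->; rewrite det_mx22 mulfV // mulr0 subr0.
Qed.

Lemma diag_invX z n : diag_inv z ^+ n = diag_inv (z ^+ n).
Proof.
elim: n => [|n IHn]; first by rewrite !expr0 /diag_inv invr1 -scalar_mx22.
by rewrite !exprS IHn -mulmxE mulmx22 !(mulr0, mul0r, addr0, add0r) /diag_inv invfM.
Qed.

Lemma has_eigenpairX A z n : has_eigenpair A z -> has_eigenpair (A ^+ n) (z ^+ n).
Proof.
case=> P uP AP; exists P => //; rewrite -diag_invX.
elim: n => [|n IHn]; first by rewrite !expr0 mulmx1 mul1mx.
by rewrite !exprS -!mulmxE -mulmxA IHn !mulmxA AP.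
Qed.

Lemma has_eigenpair_eq1 A : has_eigenpair A 1 -> A = 1.
Proof.
case=> P uP; rewrite /diag_inv invr1 -scalar_mx22 mulmx1 => AP.
by rewrite -[A](mulmxK uP) AP mulmxV.
Qed.

Lemma det_1B_has_eigenpair A z :
  has_eigenpair A z -> \det (1 - A) = (1 - z) * (1 - z^-1).
Proof.
case=> P uP AP.
have : (1 - A) *m P = P *m mx22 (1 - z) 0 0 (1 - z^-1).
  rewrite mulmxBl AP -[1]/(1%:M) mul1mx -{1}[P]mulmx1 -mulmxBr scalar_mx22.
  congr (_ *m _); apply/matrixP=> i j; rewrite !mxE.
  by case: ifP; case: ifP; rewrite ?subr0.
move/(congr1 determinant); rewrite !det_mulmx mulrC.
have uD : \det P \is a GRing.unit by rewrite -unitmxE.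
by move/(mulrI uD) ->; rewrite det_mx22 mulr0 subr0.
Qed.

Lemma subVf_neq0 z : z != 0 -> z ^+ 2 != 1 -> z - z^-1 != 0.
Proof.
move=> z0; apply: contraNneq => /eqP; rewrite subr_eq0 => /eqP zV.
by rewrite expr2 {1}zV mulVf.
Qed.

Lemma has_eigenpair_upper z b : z != 0 -> z ^+ 2 != 1 ->
  has_eigenpair (mx22 z b 0 z^-1) z.
Proof.
move=> z0 z2.
exists (mx22 1 (b / (z^-1 - z)) 0 1).
  by apply: mx22_unit; rewrite mulr0 subr0 mulr1 oner_eq0.
rewrite !mulmx22 !(mulr0, mul0r, mulr1, mul1r, addr0, add0r); congr (mx22 _ _ _ _).
by field; rewrite z0 mulNr -expr2 subr_eq0 eq_sym.
Qed.

Lemma has_eigenpair_upperV z b : z != 0 -> z ^+ 2 != 1 ->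
  has_eigenpair (mx22 z^-1 b 0 z) z.
Proof.
move=> z0 z2.
exists (mx22 (b / (z - z^-1)) 1 1 0).
  by apply: mx22_unit; rewrite mulr0 sub0r mulr1 oppr_eq0 oner_eq0.
rewrite !mulmx22 !(mulr0, mul0r, mulr1, mul1r, addr0, add0r); congr (mx22 _ _ _ _).
by field; rewrite z0 -expr2 subr_eq0.
Qed.

(** This matrix has determinant 1 and trace [x + x^-1]; the columns of the base
    change are eigenvectors. *)
Lemma has_eigenpair_antidiag x y : x != 0 -> x ^+ 2 != 1 -> y != 0 ->
  has_eigenpair (mx22 0 (- y^-1) y (x + x^-1)) x.
Proof.
move=> x0 x2 y0; have nz := subVf_neq0 x0 x2.
exists (mx22 1 1 (- (y * x)) (- (y / x))).
  apply: mx22_unit; rewrite !mul1r opprK addrC -mulrBr mulf_neq0 //.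
by rewrite !mulmx22; congr (mx22 _ _ _ _); field; rewrite ?x0 ?y0.
Qed.

(** A nonscalar matrix has a cyclic vector, in whose basis it becomes the
    companion matrix of its characteristic polynomial. *)
Lemma nonscalar_companion P : \det P = 1 -> (forall k, P <> k%:M) ->
  exists t, exists2 Q, Q \in unitmx & P *m Q = Q *m mx22 0 (- 1) 1 t.
Proof.
rewrite [P]mx22_eta; move: (P 0 0) (P 0 1) (P 1 0) (P 1 1) => a b c d.
rewrite det_mx22 => dP nsP; exists (a + d).
(* The columns of [Q v w] are the vector [(v, w)] and its image. *)
pose Q v w := mx22 v (a * v + b * w) w (c * v + d * w).
have PQ v w : mx22 a b c d *m Q v w = Q v w *m mx22 0 (- 1) 1 (a + d).
  have adE : a * d = 1 + b * c by rewrite -dP subrK.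
  by rewrite !mulmx22; congr (mx22 _ _ _ _); ring: adE.
have cyc v w : v * (c * v + d * w) - (a * v + b * w) * w != 0 ->
    exists2 R, R \in unitmx & mx22 a b c d *m R = R *m mx22 0 (- 1) 1 (a + d).
  by move=> nz; exists (Q v w) => //; apply: mx22_unit.
(* One of [(1, 0)], [(0, 1)], [(1, 1)] is no eigenvector of a nonscalar matrix. *)
case: (eqVneq c 0) => [c0|cn0]; last first.
  by apply: (cyc 1 0); rewrite !(mul1r, mulr1, mulr0, addr0, subr0).
case: (eqVneq b 0) => [b0|bn0]; last first.
  by apply: (cyc 0 1); rewrite !(mul0r, mulr1, mulr0, add0r, sub0r) oppr_eq0.
apply: (cyc 1 1); rewrite c0 b0 !mulr1 !mul1r add0r addr0 subr_eq0.
by apply/eqP=> da; apply: (nsP a); rewrite scalar_mx22 b0 c0 da.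
Qed.

(** It suffices to factor the companion matrix of [P], where only the trace of
    the second factor has to be adjusted. *)
Lemma sl2_factor P x y : x != 0 -> x ^+ 2 != 1 -> y != 0 -> y ^+ 2 != 1 ->
    \det P = 1 -> (forall k, P <> k%:M) ->
  exists A B, [/\ has_eigenpair A x, has_eigenpair B y & P = A *m B].
Proof.
move=> x0 x2 y0 y2 dP nsP; have [t [Q uQ PQ]] := nonscalar_companion dP nsP.
(* The lower left entry [y] of [A0] is what makes [A0^-1] times the companion
   matrix triangular with diagonal [(y^-1, y)], whatever [t] is. *)
pose A0 := mx22 0 (- y^-1) y (x + x^-1).
pose B0 := mx22 y^-1 (t / y - (x + x^-1)) 0 y.
exists (Q *m A0 *m invmx Q), (Q *m B0 *m invmx Q); split.
- apply: (has_eigenpair_conj uQ (mulmxKV uQ _)).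
  exact: has_eigenpair_antidiag.
- apply: (has_eigenpair_conj uQ (mulmxKV uQ _)).
  exact: has_eigenpair_upperV.
rewrite !mulmxA mulmxKV // -[_ *m A0 *m B0]mulmxA.
have -> : A0 *m B0 = mx22 0 (- 1) 1 t.
  by rewrite mulmx22; congr (mx22 _ _ _ _); field; rewrite ?x0 ?y0.
by rewrite -PQ mulmxK.
Qed.

Definition eigen_product n (z : 'I_n -> F) P :=
  exists2 A : 'I_n -> 'M[F]_2, (forall i, has_eigenpair (A i) (z i)) &
    \prod_(i < n) A i = P.

(** The parameter [-1] is for the central matrix [-1]; otherwise [z] and [z^-1]
    are kept apart, so that every triangular matrix with these diagonal entries
    is diagonalisable. *)
Definition admissible_param z := (z == -1) || ((z != 0) && (z ^+ 2 != 1)).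

Definition num_noncentral n (z : 'I_n -> F) := (\sum_(i < n) (z i ^+ 2 != 1)%R)%N.

Lemma eigen_product_cons n (z : 'I_n.+1 -> F) A P :
  has_eigenpair A (z ord0) -> eigen_product (z \o lift ord0) P ->
  eigen_product z (A *m P).
Proof.
move=> Az [B Bz <-]; exists (fun i => oapp B A (unlift ord0 i)).
  by move=> i; case: unliftP => [i' ->|->] //=; apply: Bz.
rewrite big_ord_recl unlift_none /= mulmxE; congr (_ * _).
by apply: eq_bigr => i _; rewrite liftK.
Qed.

Lemma admissible_paramP z : admissible_param z ->
  z = -1 \/ z != 0 /\ z ^+ 2 != 1.
Proof. by case/orP=> [/eqP->|/andP]; [left|right]. Qed.

Lemma has_eigenpairN1 : has_eigenpair (- 1%:M : 'M[F]_2) (-1).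
Proof.
by apply: has_eigenpairN; exists 1%:M; rewrite ?unitmx1 // /diag_inv invr1 -scalar_mx22.
Qed.

Lemma admissible_lift n (z : 'I_n.+1 -> F) :
  (forall i, admissible_param (z i)) -> forall i, admissible_param ((z \o lift ord0) i).
Proof. by move=> zP i; apply: zP. Qed.

(** A factor [-1] only changes the sign of the product that the other factors
    have to attain. *)
Lemma eigen_product_central n (z : 'I_n.+1 -> F) P : z ord0 = -1 ->
  eigen_product (z \o lift ord0) (- P) -> eigen_product z P.
Proof.
move=> z0 RP; rewrite -[P]opprK -[- P]mul1mx -mulNmx.
by apply: eigen_product_cons RP; rewrite z0; apply: has_eigenpairN1.
Qed.

Lemma eigen_product0 n (z : 'I_n -> F) : (forall i, admissible_param (z i)) ->
  num_noncentral z = 0%N -> eigen_product z 1%:M \/ eigen_product z (- 1%:M).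
Proof.
elim: n z => [|n IHn] z zP; first by left; exists (fun=> 1) => [[]//|]; rewrite big_ord0.
rewrite /num_noncentral big_ord_recl.
have [z0|[_ ->]//] := admissible_paramP (zP ord0).
rewrite z0 sqrrN expr1n eqxx add0n => /(IHn _ (admissible_lift zP))[R|R].
  by right; apply: eigen_product_central => //; rewrite opprK.
by left; apply: eigen_product_central.
Qed.

(** With a single noncentral factor the product ranges over a whole conjugacy
    class, that of this factor up to sign. *)
Lemma eigen_product1 n (z : 'I_n -> F) : (forall i, admissible_param (z i)) ->
  num_noncentral z = 1%N ->
  exists y, [/\ y != 0, y ^+ 2 != 1 & forall B, has_eigenpair B y -> eigen_product z B].
Proof.
elim: n z => [|n IHn] z zP; first by rewrite /num_noncentral big_ord0.
rewrite /num_noncentral big_ord_recl.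
have [z0|[nz0 z02]] := admissible_paramP (zP ord0).
  rewrite z0 sqrrN expr1n eqxx add0n => num1.
  have [y [y0 y2 yB]] := IHn _ (admissible_lift zP) num1.
  exists (- y); split; rewrite ?oppr_eq0 ?sqrrN // => B By.
  apply: eigen_product_central => //; apply: yB; rewrite -[y]opprK.
  exact: has_eigenpairN.
rewrite z02 add1n => -[num0].
have [R|R] := eigen_product0 (admissible_lift zP) num0.
  by exists (z ord0); split=> // B Bz; rewrite -[B]mulmx1; apply: eigen_product_cons.
exists (- z ord0); split; rewrite ?oppr_eq0 ?sqrrN // => B Bz.
rewrite -[B]opprK -[- - B]mulmx1 mulNmx -mulmxN; apply: eigen_product_cons => //.
by rewrite -[z ord0]opprK; apply: has_eigenpairN.
Qed.

(** Used to peel off a factor and keep the rest nonscalar. *)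
Lemma nonscalar_quotient P z : \det P = 1 -> z != 0 -> z ^+ 2 != 1 ->
  exists A, [/\ has_eigenpair A z, A \in unitmx & forall k, invmx A *m P <> k%:M].
Proof.
move=> dP z0 z2.
have uA c : mx22 z c 0 z^-1 \in unitmx.
  by apply: mx22_unit; rewrite mulr0 subr0 mulfV // oner_eq0.
(* If [P] were a multiple of [A] by a scalar, their upper right entries would
   vanish together; the entry of [A] is chosen to prevent this. *)
pose A := mx22 z (P 0 1 == 0)%:R 0 z^-1.
exists A; split; [exact: has_eigenpair_upper|exact: uA|move=> k].
move/(congr1 (mulmx A)); rewrite mulKVmx; last exact: uA.
rewrite scalar_mx22 mulmx22 !(mulr0, mul0r, addr0, add0r) => PE.
have: P 0 1 = (P 0 1 == 0)%:R * k by rewrite {1}PE mxE.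
case: eqP => [->|/eqP P01]; last by rewrite mul0r => /eqP; rewrite (negbTE P01).
rewrite mul1r => k0; move: dP; rewrite PE -k0 det_mx22 !mulr0 subr0.
by move/eqP; rewrite eq_sym oner_eq0.
Qed.

(** Noncentral factors are peeled off until two are left, where [sl2_factor]
    applies. *)
Lemma eigen_product2 n (z : 'I_n -> F) P : (forall i, admissible_param (z i)) ->
  (2 <= num_noncentral z)%N -> \det P = 1 -> (forall k, P <> k%:M) -> eigen_product z P.
Proof.
elim: n z P => [|n IHn] z P zP; first by rewrite /num_noncentral big_ord0.
rewrite /num_noncentral big_ord_recl.
have [z0|[nz0 z02]] := admissible_paramP (zP ord0).
  rewrite z0 sqrrN expr1n eqxx add0n => num2 dP nsP.
  apply: eigen_product_central => //; apply: IHn => //.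
  - exact: admissible_lift.
  - by rewrite -scaleN1r detZ dP sqrrN expr1n mulr1.
  by move=> k /(congr1 -%R); rewrite opprK => PE; apply: (nsP (- k)); rewrite PE raddfN.
rewrite z02 add1n ltnS leq_eqVlt => num2 dP nsP.
case/orP: num2 => [/eqP/esym num1|num2].
  have [y [y0 y2 yB]] := eigen_product1 (admissible_lift zP) num1.
  have [A [B [Az By ->]]] := sl2_factor nz0 z02 y0 y2 dP nsP.
  exact/eigen_product_cons/yB.
have [A [Az uA nsQ]] := nonscalar_quotient dP nz0 z02.
rewrite -[P](mulKVmx uA); apply: eigen_product_cons => //; apply: IHn => //.
  exact: admissible_lift.
by rewrite det_mulmx det_inv (det_has_eigenpair nz0 Az) dP invr1 mulr1.
Qed.

(** A scalar product is out of reach of [sl2_factor], but one further noncentral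
    factor leaves a nonscalar quotient for the others. *)
Lemma eigen_product3 n (z : 'I_n -> F) c : (forall i, admissible_param (z i)) ->
  (3 <= num_noncentral z)%N -> c ^+ 2 = 1 -> eigen_product z c%:M.
Proof.
elim: n z c => [|n IHn] z c zP; first by rewrite /num_noncentral big_ord0.
rewrite /num_noncentral big_ord_recl.
have [z0|[nz0 z02]] := admissible_paramP (zP ord0).
  rewrite z0 sqrrN expr1n eqxx add0n => num3 c2.
  apply: eigen_product_central => //; rewrite -raddfN; apply: IHn; rewrite ?sqrrN //.
  exact: admissible_lift.
rewrite z02 add1n ltnS => num2 c2.
have dc : \det (c%:M : 'M[F]_2) = 1 by rewrite det_scalar.
have [A [Az uA nsQ]] := nonscalar_quotient dc nz0 z02.
rewrite -[c%:M](mulKVmx uA); apply: eigen_product_cons => //; apply: eigen_product2 => //.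
  exact: admissible_lift.
by rewrite det_mulmx det_inv (det_has_eigenpair nz0 Az) dc invr1 mulr1.
Qed.

End TwoByTwo.

(** * Block rows and determinants *)

Section BlockColumns.
Local Open Scope ring_scope.
Variables (F : fieldType) (n : nat).
Local Notation N := #|{: 'I_n * 'I_2}|.
Implicit Types (X : 'I_n -> 'M[F]_(2, N)) (i j : 'I_n).

(** Both sides are the determinant of the same block matrix, eliminated in two
    ways. *)
Lemma det_1Dmulmx_comm (R : comNzRingType) p q (A : 'M[R]_(p, q)) (B : 'M_(q, p)) :
  \det (1%:M + A *m B) = \det (1%:M + B *m A).
Proof.
have e1 : block_mx 1%:M (- A) B 1%:M =
    block_mx 1%:M 0 B 1%:M *m block_mx 1%:M (- A) 0 (1%:M + B *m A).
  by rewrite mulmx_block !(mul1mx, mulmx1, mul0mx, mulmx0, addr0) mulmxN addrC addrK.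
have e2 : block_mx 1%:M (- A) B 1%:M =
    block_mx 1%:M (- A) 0 1%:M *m block_mx (1%:M + A *m B) 0 B 1%:M.
  by rewrite mulmx_block !(mul1mx, mulmx1, mul0mx, mulmx0, add0r) mulNmx addrK.
have := congr1 determinant e1; rewrite {1}e2 !det_mulmx !det_ublock !det_lblock.
by rewrite !det1 !(mul1r, mulr1).
Qed.

(** The rows are indexed through the pairs (block, row in the block), so that
    [block_inj i] is the inclusion of the [i]-th block. *)
Definition stack X : 'M[F]_N :=
  \matrix_(r, c) X (enum_val r).1 (enum_val r).2 c.

Definition block_inj i : 'M[F]_(N, 2) := \matrix_(r, s) (enum_val r == (i, s))%:R.

Lemma stackK X i : (block_inj i)^T *m stack X = X i.
Proof.
apply/matrixP=> s c; rewrite mxE (bigD1 (enum_rank (i, s))) //= !mxE enum_rankK.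
rewrite eqxx mul1r big1 ?addr0 // => r; rewrite !mxE -(inj_eq enum_val_inj) enum_rankK.
by move/negbTE ->; rewrite mul0r.
Qed.

Lemma stack_block_inj : stack (fun i => (block_inj i)^T) = 1%:M.
Proof.
apply/matrixP=> r c; rewrite !mxE -surjective_pairing (inj_eq enum_val_inj).
by rewrite eq_sym.
Qed.

Lemma block_injTK i j : (block_inj i)^T *m block_inj j = (i == j)%:R%:M.
Proof.
apply/matrixP=> s c; rewrite mxE (bigD1 (enum_rank (i, s))) //= !mxE enum_rankK.
rewrite eqxx mul1r big1 ?addr0 => [|r].
  by rewrite xpair_eqE; case: (i == j); rewrite /= ?mul0rn.
rewrite !mxE -(inj_eq enum_val_inj) enum_rankK.
by move/negbTE ->; rewrite mul0r.
Qed.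

Lemma block_injE i r : row r (block_inj i) =
  if (enum_val r).1 == i then delta_mx 0 (enum_val r).2 else 0.
Proof.
apply/rowP=> c; rewrite !mxE [enum_val r]surjective_pairing xpair_eqE /=.
by case: ifP => _; rewrite !mxE //= eq_sym.
Qed.

Lemma row_stack X r : row r (stack X) = row (enum_val r).2 (X (enum_val r).1).
Proof. by apply/rowP=> c; rewrite !mxE. Qed.

(** The block row operation is [1 + B_i W] for the inclusion [B_i] of the [i]-th
    block, and [det (1 + B_i W) = det (1 + W B_i)] with [W B_i = Y - 1]. *)
Lemma det_stack_update X X' i (Y : 'M[F]_2) (Z : 'I_n -> 'M[F]_2) :
  (forall a, a != i -> X' a = X a) ->
  X' i = Y *m X i + \sum_(j | j != i) Z j *m X j ->
  \det (stack X') = \det Y * \det (stack X).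
Proof.
move=> X'X X'i.
pose W := (Y - 1%:M) *m (block_inj i)^T
  + \sum_(j | j != i) Z j *m (block_inj j)^T.
have -> : stack X' = (1%:M + block_inj i *m W) *m stack X.
  have WX : W *m stack X = X' i - X i.
    rewrite mulmxDl -mulmxA stackK mulmxBl mul1mx X'i addrAC; congr (_ + _ - _).
    by rewrite mulmx_suml; apply: eq_bigr => j _; rewrite -mulmxA stackK.
  rewrite mulmxDl mul1mx -mulmxA WX.
  apply/row_matrixP=> r; rewrite linearD /= row_mul block_injE !row_stack.
  case: eqP => [->|/eqP ri]; last by rewrite mul0mx addr0 X'X.
  by rewrite -rowE -linearD addrC subrK.
rewrite det_mulmx det_1Dmulmx_comm mulmxDl -mulmxA block_injTK eqxx mulmx1.
rewrite mulmx_suml big1 => [|j ji]; first by rewrite addr0 addrC subrK.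
by rewrite -mulmxA block_injTK (negbTE ji) raddf0 mulmx0.
Qed.

(** The blocks are multiplied one at a time. *)
Lemma det_stack_diag X (Y : 'I_n -> 'M[F]_2) :
  \det (stack (fun a => Y a *m X a)) = (\prod_a \det (Y a)) * \det (stack X).
Proof.
pose mix (r : seq 'I_n) a := if a \in r then Y a *m X a else X a.
have -> : stack (fun a => Y a *m X a) = stack (mix (index_enum 'I_n)).
  by apply/matrixP=> r c; rewrite [LHS]mxE [RHS]mxE /mix mem_index_enum.
elim: (index_enum _) (index_enum_uniq 'I_n) => [_|i r IHr /= /andP[ir ur]].
  by rewrite big_nil mul1r; congr (\det _); apply/matrixP=> r c; rewrite !mxE.
rewrite big_cons -mulrA -IHr //.
apply: (det_stack_update (i := i) (Z := fun=> 0)) => [a /negbTE ai|].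
  by rewrite /mix inE ai.
rewrite /mix inE eqxx (negbTE ir) big1 ?addr0 // => j _.
by rewrite mul0mx.
Qed.

(** A permutation of the blocks permutes the rows; squaring makes the sign of that row
    permutation irrelevant. *)
Lemma det_stack_perm X (p : 'S_n) :
  \det (stack (X \o p)) ^+ 2 = \det (stack X) ^+ 2.
Proof.
pose f (r : 'I_N) := enum_rank (p (enum_val r).1, (enum_val r).2).
have f_inj : injective f.
  move=> r1 r2 /enum_rank_inj[/perm_inj e1 e2]; apply: enum_val_inj.
  by rewrite [LHS]surjective_pairing e1 e2 -surjective_pairing.
have -> : stack (X \o p) = row_perm (perm f_inj) (stack X).
  by apply/matrixP=> r c; rewrite !mxE permE enum_rankK.
by rewrite row_permE det_mulmx det_perm exprMn sqrr_sign mul1r.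
Qed.

End BlockColumns.

(** * Crossed homomorphisms as affine representations *)

Section AffineGroup.
Local Open Scope ring_scope.
Variables (F : fieldType) (N : nat).

(** The pair [(A, D)] stands for the affine map [x |-> A x + D] with [A] in SL2.  A
    homomorphism into this group is a representation together with a crossed
    homomorphism. *)
Definition saff := {x : 'M[F]_2 * 'M[F]_(2, N) | \det x.1 == 1}.
HB.instance Definition _ := Choice.on saff.

Definition lin (x : saff) : 'M[F]_2 := (val x).1.
Definition transl (x : saff) : 'M[F]_(2, N) := (val x).2.

Lemma det_lin x : \det (lin x) = 1. Proof. exact/eqP/(valP x). Qed.

Lemma lin_unit x : lin x \in unitmx.
Proof. by rewrite unitmxE det_lin unitr1. Qed.

Definition mk_saff (A : 'M[F]_2) (D : 'M[F]_(2, N)) (dA : \det A = 1) : saff :=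
  Sub (A, D) (introT eqP dA).

Lemma saff_eq x y : lin x = lin y -> transl x = transl y -> x = y.
Proof.
move=> el et; apply: val_inj.
by rewrite [LHS]surjective_pairing [RHS]surjective_pairing; congr (_, _).
Qed.

Lemma det_lin_mul x y : \det (lin x *m lin y) = 1.
Proof. by rewrite det_mulmx !det_lin mulr1. Qed.

Lemma det_lin_inv x : \det (invmx (lin x)) = 1.
Proof. by rewrite det_inv det_lin invr1. Qed.

Definition saff_mul x y : saff :=
  mk_saff (transl x + lin x *m transl y) (det_lin_mul x y).
Definition saff_one : saff := mk_saff 0 (det1 F 2).
Definition saff_inv x : saff :=
  mk_saff (- (invmx (lin x) *m transl x)) (det_lin_inv x).

Lemma saff_mulA : associative saff_mul.
Proof.
move=> x y z; apply: saff_eq; rewrite /lin /transl /=; first by rewrite mulmxA.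
by rewrite mulmxDr mulmxA addrA.
Qed.

Lemma saff_mul1 : left_id saff_one saff_mul.
Proof.
move=> x; apply: saff_eq; rewrite /lin /transl /=; first by rewrite mul1mx.
by rewrite mul1mx add0r.
Qed.

Lemma saff_mulr1 : right_id saff_one saff_mul.
Proof.
move=> x; apply: saff_eq; rewrite /lin /transl /=; first by rewrite mulmx1.
by rewrite mulmx0 addr0.
Qed.

Lemma saff_mulV : left_inverse saff_one saff_inv saff_mul.
Proof.
move=> x; apply: saff_eq; first exact: mulVmx (lin_unit x).
by rewrite /transl /= addNr.
Qed.

Lemma saff_mulrV : right_inverse saff_one saff_inv saff_mul.
Proof.
move=> x; apply: saff_eq; first exact: mulmxV (lin_unit x).
by rewrite {1}/transl /= {1}/transl /= mulmxN mulKVmx ?lin_unit // subrr.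
Qed.

HB.instance Definition _ := isGroup.Build saff
  saff_mulA saff_mul1 saff_mulr1 saff_mulV saff_mulrV.

Lemma lin1 : lin (1%g : saff) = 1%:M. Proof. by []. Qed.
Lemma linM (x y : saff) : lin (x * y)%g = lin x *m lin y. Proof. by []. Qed.
Lemma translM (x y : saff) : transl (x * y)%g = transl x + lin x *m transl y.
Proof. by []. Qed.
Lemma translV (x : saff) : transl (x^-1)%g = - (invmx (lin x) *m transl x).
Proof. by []. Qed.

Lemma linX (x : saff) k : lin (x ^+ k)%g = lin x ^+ k.
Proof. by elim: k => // k IHk; rewrite expgS linM IHk mulmxE -exprS. Qed.

(** Both sides come from the geometric sum [1 + A + ... + A^(k-1)], without
    dividing by [1 - A]. *)
Lemma translX (x : saff) k :
  (1%:M - lin x) *m transl (x ^+ k)%g = (1%:M - lin x ^+ k) *m transl x.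
Proof.
elim: k => [|k IHk]; first by rewrite mulmx0 subrr mul0mx.
rewrite expgS translM mulmxDr mulmxA.
have -> : (1%:M - lin x) *m lin x = lin x *m (1%:M - lin x).
  by rewrite mulmxBl mulmxBr mul1mx mulmx1.
rewrite -mulmxA IHk exprS -mulmxE mulmxA -mulmxDl mulmxBr mulmx1.
by rewrite addrA subrK.
Qed.

Lemma lin_prod (I : Type) (r : seq I) (f : I -> saff) :
  lin (\prod_(i <- r) f i)%g = \prod_(i <- r) lin (f i).
Proof.
elim: r => [|i r IHr]; first by rewrite !big_nil.
by rewrite !big_cons linM IHr mulmxE.
Qed.

(** An affine map whose linear part does not have the eigenvalue 1 is conjugate to
    its linear part, as it has a fixed point. *)
Lemma saff_order (x : saff) g :
  1%:M - lin x \in unitmx -> lin x ^+ g = 1 -> (x ^+ g)%g = 1%g.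
Proof.
move=> u xg; apply: saff_eq; first by rewrite linX xg.
by apply: (can_inj (mulKmx u)); rewrite translX xg subrr mul0mx mulmx0.
Qed.

End AffineGroup.

Section NielsenInvariant.
Local Open Scope ring_scope.
Variables (F : fieldType) (G : groupType) (n : nat).
Local Notation N := #|{: 'I_n * 'I_2}|.
Variables (Phi : G -> saff F N) (PhiM : {morph Phi : x y / (x * y)%g}).

Definition transl_det (x : n.-tuple G) := \det (stack (fun a => transl (Phi (tnth x a)))).

Let Phi1 : Phi 1%g = 1%g.
Proof. by apply: (mulgI (Phi 1%g)); rewrite -PhiM !mulg1. Qed.

Let PhiV x : Phi (x^-1)%g = (Phi x)^-1%g.
Proof. by apply: (mulgI (Phi x)); rewrite -PhiM !mulgV. Qed.

Let single (j : 'I_n) (B : 'M[F]_2) a := if a == j then B else 0.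

Let singleE (i j : 'I_n) B (X : 'I_n -> 'M[F]_(2, N)) : j != i ->
  \sum_(a | a != i) single j B a *m X a = B *m X j.
Proof.
move=> ji; rewrite (bigD1 j) //= /single eqxx big1 ?addr0 // => a /andP[_ /negbTE->].
by rewrite mul0mx.
Qed.

(** In the moves that change an entry the diagonal block is [1], the linear part
    of an entry, or minus the inverse of one, and these 2 x 2 matrices have
    determinant 1. *)
Lemma elementary_transl_det x y :
  elementary_nielsen x y -> transl_det y ^+ 2 = transl_det x ^+ 2.
Proof.
case=> {x y} [x p|x i j ji|x i j ji|x i].
- rewrite /transl_det -[in RHS](det_stack_perm _ p); congr (\det _ ^+ 2).
  by apply/matrixP=> r c; rewrite !mxE /= tnth_mktuple.
- congr (_ ^+ 2); rewrite /transl_det -[RHS]mul1r -[in RHS](det1 F 2).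
  apply: (det_stack_update (i := i) (Z := single j (lin (Phi (tnth x i)))))
    => [a /negbTE ai|]; first by rewrite tnth_mktuple ai.
  by rewrite tnth_mktuple eqxx PhiM translM mul1mx singleE.
- congr (_ ^+ 2); rewrite /transl_det -[RHS]mul1r -[in RHS](det_lin (Phi (tnth x j))).
  apply: (det_stack_update (i := i) (Z := single j 1%:M))
    => [a /negbTE ai|]; first by rewrite tnth_mktuple ai.
  by rewrite tnth_mktuple eqxx PhiM translM singleE // mul1mx addrC.
- congr (_ ^+ 2); rewrite /transl_det -[RHS]mul1r.
  have dN : \det (- invmx (lin (Phi (tnth x i)))) = 1.
    by rewrite -scaleN1r detZ det_inv det_lin invr1 sqrrN expr1n mulr1.
  rewrite -[in RHS]dN; apply: (det_stack_update (i := i) (Z := fun=> 0))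
    => [a /negbTE ai|]; first by rewrite tnth_mktuple ai.
  rewrite tnth_mktuple eqxx PhiV translV mulNmx big1 ?addr0 // => j _.
  by rewrite mul0mx.
Qed.

Lemma nielsen_transl_det x y :
  nielsen_equivalent x y -> transl_det y ^+ 2 = transl_det x ^+ 2.
Proof.
by elim=> {x y} [x y /elementary_transl_det|//|x y z _ exy _ eyz]; rewrite ?eyz.
Qed.

Lemma transl_det_powers (x : n.-tuple G) (e : 'I_n -> nat) :
  (\prod_a \det (1%:M - lin (Phi (tnth x a)))) *
    transl_det [tuple (tnth x a ^+ e a)%g | a < n] =
  (\prod_a \det (1%:M - lin (Phi (tnth x a)) ^+ e a)) * transl_det x.
Proof.
have PhiX g k : Phi (g ^+ k)%g = (Phi g ^+ k)%g.
  by elim: k => [|k IHk]; rewrite ?expg0 ?Phi1 // !expgS PhiM IHk.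
rewrite /transl_det -!det_stack_diag; congr (\det _).
by apply/matrixP=> r c; rewrite [LHS]mxE [RHS]mxE tnth_mktuple PhiX translX.
Qed.

End NielsenInvariant.

(** * The invariant of a standard tuple *)

Section PolygonRepresentation.
Local Open Scope ring_scope.
Variables (F : fieldType) (n : nat) (gamma : 'I_n.+1 -> nat).
Local Notation N := #|{: 'I_n * 'I_2}|.
Variables (z : 'I_n.+1 -> F) (A : 'I_n.+1 -> 'M[F]_2).
Hypothesis z0 : forall i, z i != 0.
Hypothesis z1 : forall i, z i != 1.
Hypothesis zg : forall i, z i ^+ gamma i = 1.
Hypothesis Az : forall i, has_eigenpair (A i) (z i).
Hypothesis prodA : \prod_(i < n.+1) A i = 1%:M.

Lemma sub1_sl2_unit i : 1%:M - A i \in unitmx.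
Proof.
rewrite unitmxE (det_1B_has_eigenpair (Az i)) unitfE mulf_neq0 // subr_eq0 eq_sym //.
by rewrite invr_eq1.
Qed.

(* All generators but the first get the translation parts of the standard block
   basis; the first is then determined by the product relation, and its order
   is right because only its linear part matters. *)
Let free_gen (a : 'I_n) : saff F N :=
  mk_saff ((block_inj F a)^T) (det_has_eigenpair (z0 (lift ord0 a)) (Az (lift ord0 a))).

Let gen_image (i : 'I_n.+1) : saff F N :=
  if unlift ord0 i is Some a then free_gen a
  else (\prod_(a < n) free_gen a)^-1%g.

Let gen_image_lift a : gen_image (lift ord0 a) = free_gen a.
Proof. by rewrite /gen_image liftK. Qed.

Let prod_gen_image : (\prod_(i < n.+1) gen_image i = 1)%g.
Proof.
rewrite big_ord_recl (eq_bigr free_gen) => [|a _]; last exact: gen_image_lift.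
by rewrite /gen_image unlift_none mulVg.
Qed.

Let lin_gen_image i : lin (gen_image i) = A i.
Proof.
case: (unliftP ord0 i) => [a ->|->]; first by rewrite gen_image_lift.
have := congr1 (@lin F N) prod_gen_image; rewrite lin1 -prodA.
rewrite lin_prod !big_ord_recl.
have -> : \prod_(a < n) A (lift ord0 a) = lin (\prod_(a < n) gen_image (lift ord0 a))%g.
  by rewrite lin_prod; apply: eq_bigr => a _; rewrite gen_image_lift.
by rewrite -lin_prod; apply: mulIr; apply: lin_unit.
Qed.

Lemma polygon_affine_representation :
  exists Phi : polygon_group gamma -> saff F N,
    [/\ {morph Phi : x y / (x * y)%g},
        forall i, lin (Phi (polygon_gen gamma i)) = A i
      & forall a, transl (Phi (polygon_gen gamma (lift ord0 a))) = (block_inj F a)^T].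
Proof.
have rel1 r : polygon_relator gamma r -> eval_word gen_image r = 1%g.
  case=> [i|]; last by rewrite eval_word_prod prod_gen_image.
  rewrite eval_word_power; apply: saff_order; rewrite lin_gen_image ?sub1_sl2_unit //.
  by apply: has_eigenpair_eq1; rewrite -(zg i); apply: has_eigenpairX.
exists (pres_lift gen_image); split.
- exact: pres_liftM.
- by move=> i; rewrite /polygon_gen pres_lift_gen.
by move=> a; rewrite /polygon_gen pres_lift_gen // gen_image_lift.
Qed.

End PolygonRepresentation.

Section TauInvariant.
Local Open Scope ring_scope.

(** The determinant of [1 - diag_inv z]; for a complex root of unity this is
    [|1 - z|^2]. *)
Definition tau (F : fieldType) (z : F) := (1 - z) * (1 - z^-1).

Lemma unity_root_neq0 (F : fieldType) (z : F) g : (0 < g)%N -> z ^+ g = 1 -> z != 0.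
Proof.
move=> g0 zg; apply/eqP=> z0; move: zg; rewrite z0 expr0n eqn0Ngt g0.
by move/eqP; rewrite eq_sym oner_eq0.
Qed.

(** The determinant at a standard tuple, computed by [transl_det_powers], is
    compared with its value at the tuples of generators; the omitted index
    contributes equally to both sides, because its exponent is 1. *)
Lemma nielsen_prod_tau (F : fieldType) (n : nat) (gamma : 'I_n.+1 -> nat)
    (z : 'I_n.+1 -> F) (e f : 'I_n.+1 -> nat) (j k : 'I_n.+1) :
  (forall i, (0 < gamma i)%N) ->
  (forall i, z i != 1) -> (forall i, z i ^+ gamma i = 1) ->
  (forall i, admissible_param (z i)) -> (3 <= num_noncentral z)%N ->
  e j = 1%N -> f k = 1%N ->
  nielsen_equivalent
    (omit_tuple j (fun i => polygon_gen gamma i ^+ e i)%g)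
    (omit_tuple k (fun i => polygon_gen gamma i ^+ f i)%g) ->
  (\prod_i tau (z i ^+ e i)) ^+ 2 = (\prod_i tau (z i ^+ f i)) ^+ 2.
Proof.
move=> g0 z1 zg zP z3 ej fk UV.
have z0 i : z i != 0 by apply: unity_root_neq0 (g0 i) (zg i).
have [A Az prodA] := eigen_product3 zP z3 (expr1n F 2).
have [Phi [PhiM PhiL PhiT]] := polygon_affine_representation z0 z1 zg Az prodA.
pose s := polygon_gen gamma.
have detA i m : \det (1%:M - A i ^+ m) = tau (z i ^+ m).
  exact/det_1B_has_eigenpair/has_eigenpairX.
have base0 : transl_det Phi (omit_tuple ord0 s) = 1.
  rewrite /transl_det -(det1 F #|{: 'I_n * 'I_2}|) -stack_block_inj; congr (\det _).
  by apply/matrixP=> r c; rewrite [LHS]mxE [RHS]mxE tnth_mktuple PhiT.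
have base j' : transl_det Phi (omit_tuple j' s) ^+ 2 = 1.
  have := nielsen_standard_tuples (e := fun=> 1%N) (f := fun=> 1%N) (gamma := gamma)
    (j := j') (k := ord0) g0 (fun i => coprime1n _) erefl erefl (fun i => or_introl erefl).
  by move/(nielsen_transl_det PhiM) => <-; rewrite [transl_det _ _]base0 expr1n.
have value (w : 'I_n.+1 -> nat) i0 : w i0 = 1%N ->
    (\prod_i tau (z i)) * transl_det Phi (omit_tuple i0 (fun i => s i ^+ w i)%g)
    = (\prod_i tau (z i ^+ w i)) * transl_det Phi (omit_tuple i0 s).
  move=> wi0; have := transl_det_powers PhiM (omit_tuple i0 s) (fun a => w (lift i0 a)).
  rewrite !(bigD1_ord i0) //= wi0 expr1 -!mulrA.
  have -> : [tuple (tnth (omit_tuple i0 s) a ^+ w (lift i0 a))%g | a < n] =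
      omit_tuple i0 (fun i => s i ^+ w i)%g.
    by apply: eq_from_tnth => a; rewrite !tnth_mktuple.
  under eq_bigr do rewrite tnth_mktuple PhiL -[A _]expr1 detA expr1.
  under [in RHS]eq_bigr do rewrite tnth_mktuple PhiL detA.
  by move->.
have tau0 : \prod_i tau (z i) != 0.
  apply/prodf_neq0 => i _; rewrite mulf_neq0 // subr_eq0 eq_sym //.
  by rewrite invr_eq1.
have tau20 : (\prod_i tau (z i)) ^+ 2 != 0 by rewrite expf_neq0.
have /(congr1 (fun x => x ^+ 2)) := value e j ej; rewrite !exprMn base mulr1 => <-.
have /(congr1 (fun x => x ^+ 2)) := value f k fk; rewrite !exprMn base mulr1 => <-.
by rewrite (nielsen_transl_det PhiM UV).
Qed.

End TauInvariant.

(** * Primitive roots of unity separate the exponents *)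

Section Separation.
Local Open Scope ring_scope.

(** [tau z = 2 - (z + z^-1)], and a sum [z + z^-1] determines [z] up to
    inversion. *)
Lemma eq_tau (F : fieldType) (a b : F) : a != 0 -> b != 0 ->
  tau a = tau b -> a = b \/ a * b = 1.
Proof.
move=> a0 b0 eab.
have : (a - b) * (a * b - 1) = 0.
  have -> : (a - b) * (a * b - 1) = a * b * (tau b - tau a) by rewrite /tau; field; rewrite a0.
  by rewrite eab subrr mulr0.
by move/eqP; rewrite mulf_eq0 !subr_eq0 => /orP[]/eqP; [left|right].
Qed.

Lemma tau_gt0 (z : algC) n : (0 < n)%N -> z ^+ n = 1 -> z != 1 -> 0 < tau z.
Proof.
move=> n0 zn z1; have zN : `|z| = 1.
  by apply/eqP; rewrite -(pexpr_eq1 n0) // -normrX zn normr1.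
rewrite /tau invC_norm zN expr1n invr1 mul1r.
have -> : 1 - z^* = (1 - z)^* by rewrite rmorphB rmorph1.
by rewrite -normCK exprn_gt0 // normr_gt0 subr_eq0 eq_sym.
Qed.

(** Applying the hypothesis to the powers of one root [y] and chaining gives
    [tau (y^(e^m)) = C^m tau (y^(f^m))].  For [m = totient g] both powers are
    [y], so [C] is a positive root of unity. *)
Lemma tau_ratio_eq1 (g e f : nat) (C : algC) : (1 < g)%N ->
  coprime e g -> coprime f g -> 0 < C ->
  (forall y : algC, g.-primitive_root y -> tau (y ^+ e) = C * tau (y ^+ f)) ->
  C = 1.
Proof.
move=> g1 ce cf C0 tauC; have g0 := ltnW g1.
have [y yP] := C_prim_root_exists g0.
have iter m : tau (y ^+ (e ^ m)) = C ^+ m * tau (y ^+ (f ^ m)).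
  suff H a b : tau (y ^+ (e ^ a * f ^ b)) = C ^+ a * tau (y ^+ (f ^ (a + b))).
    by have := H m 0; rewrite muln1 addn0.
  elim: a b => [|a IHa] b; first by rewrite mul1n mul1r.
  have yab : g.-primitive_root (y ^+ (e ^ a * f ^ b)).
    by rewrite prim_root_exp_coprime // coprimeMl !coprimeXl.
  rewrite expnS -mulnA mulnC exprM tauC // -exprM -mulnA -expnSr IHa.
  by rewrite mulrA -exprS addSnnS.
have t0 : (0 < totient g)%N by rewrite totient_gt0.
have := iter (totient g).
rewrite -!(prim_expr_mod yP (_ ^ _)) !Euler_exp_totient // => yC.
have tau0 : tau (y ^+ (1 %% g)) != 0.
  rewrite gt_eqF // prim_expr_mod // (tau_gt0 g0) ?expr1 ?prim_expr_order //.
  by rewrite -[y]expr1 -(prim_order_dvd yP) dvdn1 gtn_eqF.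
apply/eqP; rewrite -(pexpr_eq1 t0) ?ltW //; apply/eqP.
by apply: (mulIf tau0); rewrite mul1r -yC.
Qed.

(** The roots other than [z i0] are kept fixed, and their factors form the
    constant of [tau_ratio_eq1]. *)
Lemma prod_tau_separation (I : finType) (gamma e f : I -> nat) (i0 : I) :
  (forall i, 1 < gamma i)%N ->
  (forall i, coprime (e i) (gamma i)) -> (forall i, coprime (f i) (gamma i)) ->
  (forall z : I -> algC, (forall i, (gamma i).-primitive_root (z i)) ->
     (\prod_i tau (z i ^+ e i)) ^+ 2 = (\prod_i tau (z i ^+ f i)) ^+ 2) ->
  e i0 = f i0 %[mod gamma i0] \/ (gamma i0 %| e i0 + f i0)%N.
Proof.
move=> g1 ce cf H.
have g0 i : (0 < gamma i)%N := ltnW (g1 i).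
pose z i := sval (C_prim_root_exists (g0 i)).
have zP i : (gamma i).-primitive_root (z i) := svalP (C_prim_root_exists (g0 i)).
have tau_pos i y w : (gamma i).-primitive_root y -> coprime w (gamma i) ->
    0 < tau (y ^+ w) :> algC.
  move=> yP cw; apply: (tau_gt0 (g0 i)); first by rewrite exprAC (prim_expr_order yP) expr1n.
  rewrite -(prim_order_dvd yP); apply: contraTN cw => gw.
  by rewrite /coprime (gcdn_idPr gw) gtn_eqF.
pose P w := \prod_(i | i != i0) tau (z i ^+ w i).
have P0 w : (forall i, coprime (w i) (gamma i)) -> 0 < P w.
  by move=> cw; apply: prodr_gt0 => i _; apply: tau_pos.
pose C := P f / P e.
have C0 : 0 < C by rewrite divr_gt0 ?P0.
have tauC y : (gamma i0).-primitive_root y -> tau (y ^+ e i0) = C * tau (y ^+ f i0).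
  move=> yP; pose z' i := if i == i0 then y else z i.
  have z'P i : (gamma i).-primitive_root (z' i) by rewrite /z'; case: eqP => [->|].
  have prodE w : \prod_i tau (z' i ^+ w i) = tau (y ^+ w i0) * P w.
    rewrite (bigD1 i0) //= {1}/z' eqxx; congr (_ * _).
    by apply: eq_bigr => i /negbTE ii0; rewrite /z' ii0.
  have /eqP := H z' z'P; rewrite !prodE eqrXn2 //; last first.
  - by rewrite mulr_ge0 ?ltW ?P0 ?(tau_pos i0).
  - by rewrite mulr_ge0 ?ltW ?P0 ?(tau_pos i0).
  move/eqP=> eP; apply: (mulIf (lt0r_neq0 (P0 e ce))).
  by rewrite eP /C [RHS]mulrAC divfK ?lt0r_neq0 ?P0 // mulrC.
have C1 := tau_ratio_eq1 (g1 i0) (ce i0) (cf i0) C0 tauC.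
have := tauC _ (zP i0); rewrite C1 mul1r => /eq_tau.
have zi0 := unity_root_neq0 (g0 i0) (prim_expr_order (zP i0)).
rewrite !expf_neq0 // => /(_ isT isT)[/eqP|/eqP].
  by rewrite (eq_prim_root_expr (zP i0)) => /eqP; left.
by rewrite -exprD -(prim_order_dvd (zP i0)); right.
Qed.

End Separation.

Section RepresentationParameters.
Local Open Scope ring_scope.
Variables (F : fieldType) (n : nat) (gamma : 'I_n -> nat) (z : 'I_n -> F).
Hypothesis gamma_ge2 : forall i, (2 <= gamma i)%N.
Hypothesis zP : forall i, (gamma i).-primitive_root (z i).

Lemma primitive_root_sqr i : (z i ^+ 2 != 1) = (3 <= gamma i)%N.
Proof.
rewrite -(prim_order_dvd (zP i)).
have := gamma_ge2 i; rewrite leq_eqVlt => /predU1P[<-|g3]; first by rewrite dvdnn.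
by rewrite g3; apply/negP=> /(@dvdn_leq _ 2 isT); rewrite leqNgt g3.
Qed.

Lemma primitive_root_neq1 i : z i != 1.
Proof.
rewrite -[z i]expr1 -(prim_order_dvd (zP i)) dvdn1.
by rewrite gtn_eqF.
Qed.

Lemma primitive_root_admissible i : admissible_param (z i).
Proof.
rewrite /admissible_param; case: (eqVneq (z i ^+ 2) 1) => [/eqP|z2].
  by rewrite sqrf_eq1 (negbTE (primitive_root_neq1 i)) => /= ->.
by rewrite (unity_root_neq0 _ (prim_expr_order (zP i))) ?orbT // ltnW.
Qed.

Lemma num_noncentral_primitive : num_noncentral z = #|[pred i | (3 <= gamma i)%N]|.
Proof.
rewrite -sum1_card big_mkcond; apply: eq_bigr => i _ /=.
by rewrite primitive_root_sqr inE; case: leqP.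
Qed.

End RepresentationParameters.

(** * The classification *)

Theorem theorem1p2 (l : nat) (gamma : 'I_l -> nat) (m n : nat)
    (j k : 'I_l) (u v : 'I_l -> int)
    (U V : (l.-1).-tuple (polygon_group gamma)) :
  3 <= l ->
  (forall i, 2 <= gamma i) ->
  m = #|[pred i | 3 <= gamma i]| ->
  n = #|[pred i | gamma i == 2]| ->
  (~~ odd n -> 5 <= m) ->
  (odd n -> 7 <= m) ->
  standard_generating_system j u U ->
  standard_generating_system k v V ->
  u j = 1%Z ->
  v k = 1%Z ->
  nielsen_equivalent U V <->
  (forall i : 'I_l,
     (u i = v i %[mod (gamma i)%:Z])%Z \/ (u i = - v i %[mod (gamma i)%:Z])%Z).
Proof.
case: l gamma j k u v U V => [|l] gamma j k u v U V; first by case: j.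
move=> _ g2 mE _ m5 m7 [cu ->] [cv ->] uj vk.
have {m5 m7} m3 : 3 <= m.
  by case: (boolP (odd n)) => [/m7|/m5]; apply: leq_trans.
have g0 i : 0 < gamma i := ltnW (g2 i).
pose e i := residue (u i) (gamma i); pose f i := residue (v i) (gamma i).
have residue1 i : residue 1%Z (gamma i) = 1 by rewrite /residue modz_nat absz_nat modn_small.
have ej : e j = 1 by rewrite /e uj residue1.
have fk : f k = 1 by rewrite /f vk residue1.
have ce i : coprime (e i) (gamma i).
  by case: (eqVneq i j) => [->|/cu/coprime_residue//]; rewrite ej coprime1n.
have cf i : coprime (f i) (gamma i).
  by case: (eqVneq i k) => [->|/cv/coprime_residue//]; rewrite fk coprime1n.
have tupleE (i0 : 'I_l.+1) (w : 'I_l.+1 -> int) :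
    [tuple expgz (polygon_gen gamma (lift i0 a)) (w (lift i0 a)) | a < l] =
    omit_tuple i0 (fun i => polygon_gen gamma i ^+ residue (w i) (gamma i))%g.
  apply: eq_from_tnth => a; rewrite !tnth_mktuple.
  exact/expgz_residue/polygon_gen_order.
rewrite !tupleE -/e -/f; split=> [UV i|uv].
  have [ef|ef] : e i = f i %[mod gamma i] \/ gamma i %| e i + f i.
  - apply: prod_tau_separation => // z zP.
    apply: (nielsen_prod_tau g0 _ _ _ _ ej fk UV) => [a|a|a|].
    + exact: primitive_root_neq1 zP a.
    + exact: prim_expr_order.
    + exact: primitive_root_admissible zP a.
    by rewrite (num_noncentral_primitive g2 zP) -mE.
  - by left; apply/residue_eqP.
  by right; apply/residue_oppP.
apply: nielsen_standard_tuples => // i.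
have s1 := polygon_gen_order gamma i.
have [/residue_eqP ef|/residue_oppP ef] := uv i.
  by left; rewrite -(expg_modn _ s1) -ef // (expg_modn _ s1).
right; apply: (mulgI (polygon_gen gamma i ^+ e i)%g); rewrite mulgV -expgnDr.
by case/dvdnP: (ef (g0 i)) => q ->; rewrite mulnC expgnA s1 expg1n.
Qed.
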